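(* Let $m\ge 2$ and $1\le k\le m$ be integers, let $1\le p\le\infty$, let $\mu$ be a measure, and let $m'$ and $p'$ be the conjugate exponents of $m$ and $p$ respectively. Put \[ C_{k,m}= \begin{cases} \dfrac{k!\,m^{m/p}}{(m-k)^{(m-k)/p}\,k^{k/p}} & \text{if } 1\le p\le m',\\[2mm] \dfrac{k!\,m^{m/m'}}{(m-k)^{(m-k)/m'}\,k^{k/m'}} & \text{if } m'\le p\le m,\\[2mm] \dfrac{k!\,m^{m/p'}}{(m-k)^{(m-k)/p'}\,k^{k/p'}} & \text{if } m\le p\le\infty. \end{cases} \] Then for every continuous $m$-homogeneous polynomial $\widehat{L}:L_p(\mu)\to\mathbb{R}$ on the real space $L_p(\mu)$, \[ \|\widehat{D}^{k}\widehat{L}\|\le 2^{m-1}\,C_{k,m}\,\|\widehat{L}\|. \]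
   Context: Conjugate exponents: $q'=q/(q-1)$ for $1<q<\infty$, $1'=\infty$, $\infty'=1$. When $k=m$, the factor $(m-k)^{(m-k)/\cdot}$ is read as $0^0=1$. For a Banach space $X$ over $\mathbb{K}$ ($\mathbb{R}$ or $\mathbb{C}$), a continuous $m$-homogeneous polynomial on $X$ is a map $\widehat{L}:X\to\mathbb{K}$ of the form $\widehat{L}(x)=L(x,\dots,x)$, where $L:X^m\to\mathbb{K}$ is a continuous symmetric $m$-linear form ($L$ is uniquely determined by $\widehat{L}$). Its norm is $\|\widehat{L}\|=\sup\{|\widehat{L}(x)|:\|x\|\le 1\}$. $D^k\widehat{L}(x)$ is the $k$th Fréchet derivative of $\widehat{L}$ at $x$, a continuous symmetric $k$-linear form on $X$, and $\widehat{D}^k\widehat{L}(x)$ is the associated $k$-homogeneous polynomial $y\mapsto D^k\widehat{L}(x)(y,\dots,y)$; explicitly $\widehat{D}^k\widehat{L}(x)y=k!\binom{m}{k}L(\underbrace{x,\dots,x}_{m-k},\underbrace{y,\dots,y}_{k})$. Norms: $\|\widehat{D}^k\widehat{L}(x)\|=\sup_{\|y\|\le 1}|\widehat{D}^k\widehat{L}(x)y|$ and $\|\widehat{D}^k\widehat{L}\|=\sup_{\|x\|\le 1}\|\widehat{D}^k\widehat{L}(x)\|$. *)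

(* Defs.v *)
From HB Require Import structures.
From mathcomp Require Import all_boot all_order all_algebra perm.
From mathcomp Require Import generic_quotient.
From mathcomp Require Import all_classical all_reals all_analysis.
From mathcomp Require Import ess_sup_inf measurable_realfun.

Set Implicit Arguments.
Unset Strict Implicit.
Unset Printing Implicit Defensive.
Import Order.TTheory GRing.Theory Num.Theory.
Import numFieldNormedType.Exports.
Local Open Scope classical_set_scope.
Local Open Scope ring_scope.
Local Open Scope quotient_scope.

(* The library gives [LspaceType], the almost-everywhere classes of functions
   with finite p-norm (1 <= p <= +oo), neither operations nor a norm; they are
   defined through representatives. *)
Section Lspace_normed.
Context d (T : measurableType d) (R : realType).
Context (mu : {measure set T -> \bar R}) (p : \bar R) (p1 : (1 <= p)%E).
Local Notation Lfun := (LfunType mu p1).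
Local Notation Lspace := (LspaceType mu p1).
Implicit Types (f g h : Lfun) (u v w : Lspace) (a b : R).

Lemma ae_eq_Lnorm (f g : T -> R) : measurable_fun setT f ->
  measurable_fun setT g -> f = g %[ae mu] ->
  ('N[mu]_p[EFin \o f] = 'N[mu]_p[EFin \o g])%E.
Proof.
move=> mf mg fg; rewrite unlock.
case: p p1 => [r|_|//] /=; last first.
  by case: ifP => // _; apply: eq_ess_sup; apply: filterS fg => x /= ->.
rewrite lee_fin => r1; congr (_ `^ _)%E.
have mpow (h : T -> R) : measurable_fun setT h ->
    measurable_fun setT (fun x => (`|h x| `^ r)%:E : \bar R).
  move=> mh; apply/measurable_EFinP.
  apply: (@measurableT_comp _ _ _ _ _ _ (@powR R ^~ r)) => //.
  exact: measurableT_comp.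
apply: ge0_ae_eq_integral => //.
- exact: mpow.
- exact: mpow.
- by apply: filterS fg => x /= fgx _; rewrite fgx.
Qed.

Let Lrep_mem u : (repr (u : {mfun_ mu, T >-> measurableTypeR R}) : T -> R)
  \in hoelder.Lfun mu p.
Proof.
apply/andP; split; first by rewrite inE; exact: (@measurable_funPT _ _ _ _
  (repr (u : {mfun_ mu, T >-> measurableTypeR R}))).
by rewrite inE/=; exact: (@Lebesgue_finite _ _ _ _ _ p1 u).
Qed.

Definition Lspace_repr u : Lfun := Lfun_Sub p1 (Lrep_mem u).

(* [{mfun T >-> R}] and [{mfun T >-> measurableTypeR R}] only differ by the
   display of the Borel sigma-algebra on the codomain. *)
Let borel_mfun f : {mfun T >-> measurableTypeR R} :=
  HB.pack_for {mfun T >-> measurableTypeR R} (f : T -> measurableTypeR R)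
    (@isMeasurableFun.Build d _ T (measurableTypeR R) f
       (@measurable_funPT _ _ _ _ f)).

Let Lclass_fin f : finite_norm mu p
  (aqEqMfun_to_fun (\pi_({mfun_ mu, T >-> measurableTypeR R}) (borel_mfun f))).
Proof.
rewrite /finite_norm (_ : ('N[mu]_p[_] = 'N[mu]_p[EFin \o f])%E).
  exact: Lfunction_finite.
apply: ae_eq_Lnorm => //.
  exact: (@measurable_funPT _ _ _ _
    (repr (\pi_({mfun_ mu, T >-> measurableTypeR R}) (borel_mfun f)))).
by have /eqquotP/asboolP := reprK (\pi_({mfun_ mu, T >-> measurableTypeR R}) (borel_mfun f)).
Qed.

Definition Lspace_pi f : Lspace :=
  @LebesgueSpace.Pack _ _ _ _ _ _ (\pi_({mfun_ mu, T >-> measurableTypeR R}) (borel_mfun f))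
    (LebesgueSpace.Class (@isFinLebesgue.Build _ _ _ _ _ p1 _ (Lclass_fin f))).

Let Lspace_inj u v :
  u = v :> {mfun_ mu, T >-> measurableTypeR R} -> u = v.
Proof.
case: u v => u [[uf]] [v [[vf]]] /= uv; case: _ / uv in vf *.
by rewrite (Prop_irrelevance uf vf).
Qed.

Lemma Lspace_piP f g : Lspace_pi f = Lspace_pi g <-> f = g %[ae mu].
Proof.
split=> [|fg].
  by move=> /(congr1 (@LebesgueSpace.sort _ _ _ _ _ _))/eqquotP/asboolP.
by apply: Lspace_inj; apply/eqquotP/asboolP.
Qed.

Lemma Lspace_reprK : cancel Lspace_repr Lspace_pi.
Proof.
move=> u; apply: Lspace_inj => /=.
rewrite -[RHS](reprK (u : {mfun_ mu, T >-> measurableTypeR R})).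
by congr (\pi _); apply/mfuneqP.
Qed.

Lemma Lspace_reprP f : Lspace_repr (Lspace_pi f) = f %[ae mu].
Proof. by apply/Lspace_piP; rewrite Lspace_reprK. Qed.

HB.instance Definition _ := gen_eqMixin Lspace.
HB.instance Definition _ := gen_choiceMixin Lspace.

Let add u v : Lspace := Lspace_pi (Lspace_repr u + Lspace_repr v).
Let opp u : Lspace := Lspace_pi (- Lspace_repr u).
Let scale a u : Lspace := Lspace_pi (a *: Lspace_repr u).

Let addE f g : add (Lspace_pi f) (Lspace_pi g) = Lspace_pi (f + g).
Proof.
apply/Lspace_piP; have := Lspace_reprP g; have := Lspace_reprP f.
by apply: filterS2 => x /= /(_ I) fx /(_ I) gx _; congr (_ + _).
Qed.

Let oppE f : opp (Lspace_pi f) = Lspace_pi (- f).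
Proof.
apply/Lspace_piP; have := Lspace_reprP f.
by apply: filterS => x /= /(_ I) fx _; congr (- _).
Qed.

Let scaleE a f : scale a (Lspace_pi f) = Lspace_pi (a *: f).
Proof.
apply/Lspace_piP; have := Lspace_reprP f.
by apply: filterS => x /= /(_ I) fx _; congr (_ *: _).
Qed.

Let addA : associative add.
Proof.
move=> u v w; rewrite -(Lspace_reprK u) -(Lspace_reprK v) -(Lspace_reprK w).
by rewrite !addE addrA.
Qed.

Let addC : commutative add.
Proof. by move=> u v; rewrite /add addrC. Qed.

Let add0 : left_id (Lspace_pi 0) add.
Proof. by move=> u; rewrite -(Lspace_reprK u) addE add0r. Qed.

Let addN : left_inverse (Lspace_pi 0) opp add.
Proof. by move=> u; rewrite -(Lspace_reprK u) oppE addE addNr. Qed.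

HB.instance Definition _ := GRing.isZmodule.Build Lspace addA addC add0 addN.

Let scaleA a b u : scale a (scale b u) = scale (a * b) u.
Proof. by rewrite -(Lspace_reprK u) !scaleE scalerA. Qed.

Let scale1 : left_id 1 scale.
Proof. by move=> u; rewrite -(Lspace_reprK u) scaleE scale1r. Qed.

Let scaleDr : right_distributive scale +%R.
Proof.
move=> a u v; rewrite -(Lspace_reprK u) -(Lspace_reprK v).
by rewrite [_ + _]addE !scaleE [RHS]addE scalerDr.
Qed.

Let scaleDl u : {morph scale^~ u : a b / a + b}.
Proof.
by move=> a b; rewrite -(Lspace_reprK u) !scaleE [RHS]addE scalerDl.
Qed.

HB.instance Definition _ :=
  GRing.Zmodule_isLmodule.Build R Lspace scaleA scale1 scaleDr scaleDl.

Lemma Lspace_piD f g : Lspace_pi (f + g) = Lspace_pi f + Lspace_pi g.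
Proof. by rewrite -addE. Qed.

Lemma Lspace_piZ a f : Lspace_pi (a *: f) = a *: Lspace_pi f.
Proof. by rewrite -scaleE. Qed.

Let nm u : R := fine ('N[mu]_p[EFin \o Lspace_repr u])%E.

Let nm_pi f : nm (Lspace_pi f) = fine ('N[mu]_p[EFin \o f])%E.
Proof.
congr fine; apply: ae_eq_Lnorm => //.
exact: Lspace_reprP.
Qed.

Let nmD u v : nm (u + v) <= nm u + nm v.
Proof.
rewrite -(Lspace_reprK u) -(Lspace_reprK v) -Lspace_piD !nm_pi.
exact: ler_LnormD.
Qed.

Let nmZ a u : nm (a *: u) = `|a| * nm u.
Proof.
rewrite -(Lspace_reprK u) -Lspace_piZ !nm_pi.
have -> : EFin \o (a *: Lspace_repr u) = EFin \o (a \*: Lspace_repr u).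
  exact/funext.
by rewrite LnormZ -finite_norm_fine.
Qed.

Let nm0 u : nm u = 0 -> u = 0.
Proof.
rewrite -(Lspace_reprK u) nm_pi => /fine_Lnormr_eq0 u0.
exact/Lspace_piP.
Qed.

HB.instance Definition _ := Lmodule_isNormed.Build R Lspace nmD nmZ nm0.

Lemma Lspace_normE f : `|Lspace_pi f|%:E = ('N[mu]_p[EFin \o f])%E.
Proof. by rewrite [`|_|]nm_pi finite_norm_fine. Qed.

End Lspace_normed.

Section continuous_linear_maps.
Context (R : realType) (X Y : normedModType R).

Definition clinear : {pred X -> Y} :=
  [pred f | `[< linear f /\ continuous f >]].

Let clinear_submod : submod_closed clinear.
Proof.
split=> [|a f g /asboolP[lf cf] /asboolP[lg cg]]; apply/asboolP; split.
- by move=> a x y; rewrite scaler0 addr0.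
- by move=> x; exact: cvg_cst.
- move=> b x y; rewrite !fctE lf lg !scalerDr !scalerA (mulrC a b).
  by rewrite addrACA.
- by move=> x; apply: cvgD; [apply: cvgZr; exact: cf|exact: cg].
Qed.

HB.instance Definition _ := GRing.isSubmodClosed.Build R (X -> Y) clinear
  clinear_submod.

Record clinType := CLin { clin_fun :> X -> Y; _ : clin_fun \in clinear }.

HB.instance Definition _ := [isSub for clin_fun].
HB.instance Definition _ := [Choice of clinType by <:].
HB.instance Definition _ := [SubChoice_isSubLmodule of clinType by <:].

Implicit Types f g : clinType.

Let unit_values f : set R := [set `|f x| | x in [set x | `|x| <= 1]].

Let nm f : R := sup (unit_values f).

Lemma clin_linear f : linear f.
Proof. by case: f => f /= /asboolP[]. Qed.

Lemma clin_continuous f : continuous f.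
Proof. by case: f => f /= /asboolP[]. Qed.

Let has_sup_values f : has_sup (unit_values f).
Proof.
split; first by exists `|f 0|; exists 0 => //=; rewrite normr0.
pose F : {linear X -> Y} := HB.pack_for {linear X -> Y} (f : X -> Y)
  (GRing.isLinear.Build R X Y _ f (clin_linear f)).
have /linear_bounded_continuous/bounded_funP/(_ 1)[M fM] : continuous F.
  exact: clin_continuous.
by exists M => _ [x /= x1 <-]; exact: fM.
Qed.

Let nm_ub f x : `|x| <= 1 -> `|f x| <= nm f.
Proof. by move=> x1; apply: ub_le_sup; [exact: (has_sup_values f).2|exists x]. Qed.

Let clinZ f a x : f (a *: x) = a *: f x.
Proof.
have f0 : f 0 = 0.
  have := clin_linear f (-1) 0 0.
  by rewrite scaler0 addr0 scaleN1r addNr.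
by have := clin_linear f a x 0; rewrite !addr0 f0 addr0.
Qed.

Let nm_bound f x : `|f x| <= nm f * `|x|.
Proof.
have [->|x0] := eqVneq x 0.
  by have := clinZ f 0 0; rewrite !scale0r => ->; rewrite !normr0 mulr0.
have nx : 0 < `|x| by rewrite normr_gt0.
have : `|f (`|x|^-1 *: x)| <= nm f.
  by apply: nm_ub; rewrite normrZ normfV normr_id mulVf// gt_eqF.
by rewrite clinZ normrZ normfV normr_id mulrC ler_pdivrMr.
Qed.

Let nmD f g : nm (f + g) <= nm f + nm g.
Proof.
apply: ge_sup; first exact: (has_sup_values _).1.
move=> _ [x /= x1 <-]; rewrite (le_trans (ler_normD _ _))//.
by apply: lerD; exact: nm_ub.
Qed.

Let nmZ_le a f : nm (a *: f) <= `|a| * nm f.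
Proof.
apply: ge_sup; first exact: (has_sup_values _).1.
by move=> _ [x /= x1 <-]; rewrite normrZ ler_wpM2l// nm_ub.
Qed.

Let nmZ a f : nm (a *: f) = `|a| * nm f.
Proof.
apply/eqP; rewrite eq_le nmZ_le/=.
have [->|a0] := eqVneq a 0.
  rewrite normr0 mul0r; apply: le_trans (nm_ub _ (x := 0) _) => //.
  by rewrite normr0.
rewrite mulrC -ler_pdivlMr ?normr_gt0// mulrC -normfV.
by rewrite -[f in leLHS]scale1r -(mulVf a0) -scalerA nmZ_le.
Qed.

Let nm0 f : nm f = 0 -> f = 0.
Proof.
move=> f0; apply/val_inj/funext => x /=; apply/eqP.
by rewrite -normr_le0 (le_trans (nm_bound f x))// f0 mul0r.
Qed.

HB.instance Definition _ := Lmodule_isNormed.Build R clinType nmD nmZ nm0.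

Lemma clin_normE f :
  `|f| = sup [set `|f x| | x in [set x | `|x| <= 1]].
Proof. by []. Qed.

(* [0] when [f] is not continuous linear. *)
Definition clin_of (f : X -> Y) : clinType := insubd 0 f.
End continuous_linear_maps.

Arguments clinear {R X Y}.

Section frechet_derivatives.
Context (R : realType) (X : normedModType R).

Definition multilinear m (L : ('I_m -> X) -> R) :=
  forall (i : 'I_m) (x : 'I_m -> X), scalar (fun y => L (dfwith x i y)).

Definition symmetric_mform m (L : ('I_m -> X) -> R) :=
  forall (s : 'S_m) (x : 'I_m -> X), L (x \o s) = L x.

Definition continuous_hpoly m (P : X -> R) :=
  exists L : {ptws 'I_m -> X} -> R,
    [/\ multilinear L, symmetric_mform L, continuous L
      & forall x, P x = L (fun=> x)].

(* Curried continuous k-linear forms: L(X, L(X, ... L(X, R))), whose iterated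
   operator norm is the usual norm of k-linear forms. *)
Fixpoint mlinType k : normedModType R :=
  if k is j.+1 then clinType X (mlinType j) else R^o.

(* [frechet k f x] is the k-th derivative of [f] at [x]. The most recent
   direction is the first argument; where the previous derivative is not
   differentiable, ['d] and [clin_of] yield a default value. *)
Fixpoint frechet k (f : X -> R) : X -> mlinType k :=
  if k is j.+1 then fun x => clin_of ('d (frechet j f) x) else f.

Fixpoint mlin_diag k : mlinType k -> X -> R :=
  if k is j.+1 then fun A y => mlin_diag (A y) y else fun a _ => a.

Definition poly_norm (P : X -> R) : \bar R :=
  ereal_sup [set `|P x|%:E | x in [set x | `|x| <= 1]].

Definition frechet_norm k (P : X -> R) : \bar R :=
  ereal_sup [set poly_norm (mlin_diag (frechet k P x))
            | x in [set x | `|x| <= 1]].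

End frechet_derivatives.

Section constants.
Context {R : realType}.
Implicit Types p q : \bar R.

(* k! m^(m/q) / ((m-k)^((m-k)/q) k^(k/q)); the exponents are 0 when q = +oo,
   and powR satisfies 0 `^ 0 = 1. *)
Definition Cexponent (k m : nat) q : R :=
  let e n := fine (n%:R%:E / q)%E in
  k`!%:R * m%:R `^ e m / ((m - k)%:R `^ e (m - k)%N * k%:R `^ e k).

Definition Cconst (k m : nat) p : R :=
  let m' := hoelder_conjugate m%:R%:E in
  if (p <= m')%E then Cexponent k m p
  else if (p <= m%:R%:E)%E then Cexponent k m m'
  else Cexponent k m (hoelder_conjugate p).

End constants.

(* Main.v *)
From HB Require Import structures.
Require Import Defs.
From mathcomp Require Import all_boot all_order all_algebra.
From mathcomp Require Import perm cyclic separable cyclotomic.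
From mathcomp Require Import all_classical all_reals all_analysis.
From mathcomp Require Import complex ring lra zify.
Import Order.TTheory GRing.Theory Num.Theory.
Import numFieldNormedType.Exports.
Local Open Scope classical_set_scope.
Local Open Scope ring_scope.

(** The estimate holds in every real normed space. For unit vectors x and y put
    b_j = L(x^(m-j) y^j), so that D^k P(x) y^k = k! C(m,k) b_k, and let
    a = (m-k)/m, b = k/m. On the circle s^2 + t^2 = 1 the vector
    s sqrt(a) x + t sqrt(b) y has norm at most 1 by Cauchy-Schwarz, so Banach's
    theorem on the symmetric forms of a Euclidean plane gives
    |b_k| <= |P| / sqrt(a^(m-k) b^k). Now C(m,k) <= 2^(m-1), and in each of the
    three ranges of p the constant C_{k,m} equals k! / (a^(m-k) b^k)^(1/q) with
    q <= 2.

    Banach's planar theorem comes from a quadrature formula: the polarization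
    of a form of degree n at two unit vectors is a combination of its values at
    n points of the circle whose coefficients have total mass 1, because up to
    unimodular factors they are values of a Fejer kernel. *)

Set Implicit Arguments.
Unset Strict Implicit.
Unset Printing Implicit Defensive.

(** * Symmetric forms on the Euclidean plane: quadrature on the circle and Banach's theorem *)

Section Planar.
Variable C : numClosedFieldType.
Implicit Types (v w z : C) (B : {poly C} -> C).

Lemma closed_prim_root_exists n : (0 < n)%N -> exists z : C, n.-primitive_root z.
Proof.
move=> n0; have [r Dr] := closed_field_poly_normal ('X^n - 1 : {poly C}).
rewrite (monicP (monicXnsubC _ n0)) scale1r in Dr.
have rn : all n.-unity_root r by apply/allP => z; rewrite -root_prod_XsubC -Dr.
have ur : uniq r.
  by rewrite -separable_prod_XsubC -Dr separable_Xn_sub_1 // pnatr_eq0 -lt0n.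
have nr : (n <= size r)%N.
  by rewrite -ltnS -(size_prod_XsubC r id) -Dr size_XnsubC.
by have /hasP[z _ pz] := has_prim_root n0 rn ur nr; exists z.
Qed.

(** The roots are one [n]-th root of [v] times the powers of a primitive root of unity, so each
    power sum contains a geometric sum that vanishes unless [n] divides the exponent. *)
Lemma power_sums_of_roots n (v : C) : (0 < n)%N -> exists r : 'I_n -> C,
  (forall j, r j ^+ n = v) /\
  (forall i, \sum_j r j ^+ i = if (n %| i)%N then n%:R * v ^+ (i %/ n) else 0).
Proof.
move=> n0; have [e pe] := closed_prim_root_exists n0.
have r0n : n.-root v ^+ n = v by rewrite rootCK.
exists (fun j => n.-root v * e ^+ j); split => [j|i].
  by rewrite exprMn r0n -exprM mulnC exprM (prim_expr_order pe) expr1n mulr1.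
have -> : \sum_(j < n) (n.-root v * e ^+ j) ^+ i =
    n.-root v ^+ i * \sum_(j < n) (e ^+ i) ^+ j.
  by rewrite mulr_sumr; apply: eq_bigr => j _; rewrite exprMn -!exprM mulnC.
case: ifPn => [/dvdnP[q ->]|ni].
  rewrite mulnK// mulnC exprM r0n exprM (prim_expr_order pe) expr1n.
  under eq_bigr do rewrite expr1n.
  by rewrite sumr_const card_ord mulrC.
apply/eqP; rewrite mulf_eq0; apply/orP; right.
have : (e ^+ i - 1) * \sum_(j < n) (e ^+ i) ^+ j == 0.
  by rewrite -subrX1 -exprM mulnC exprM (prim_expr_order pe) expr1n subrr.
by rewrite mulf_eq0 subr_eq0 -(prim_order_dvd pe) (negPf ni).
Qed.

(* Up to unimodular factors, the weights [l j] are values of a Fejer kernel; its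
   nonnegativity makes [\sum_j `|l j|] computable as a power sum. *)
Lemma fejer_quadrature n w : (0 < n)%N -> `|w| = 1 ->
  exists h l : 'I_n -> C, [/\ forall j, `|h j| = 1, \sum_j `|l j| = 1 &
    forall a, (a <= n)%N ->
      (\sum_j l j * (h j ^+ a * (h j)^-1 ^+ (n - a))) *+ n =
      w *+ a + w^-1 *+ (n - a)].
Proof.
move=> n0 w1.
have w0 : w != 0 by rewrite -normr_eq0 w1 oner_eq0.
have nC0 : n%:R != 0 :> C by rewrite pnatr_eq0 -lt0n.
have [r [rn rS]] := power_sums_of_roots (w ^+ 2) n0.
have r1 j : `|r j| = 1.
  apply/eqP; rewrite -(@pexpr_eq1 _ _ n)// ?normr_ge0//.
  by rewrite -normrX rn normrX w1 expr1n.
have r0 j : r j != 0 by rewrite -normr_eq0 r1 oner_eq0.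
(* [D j] is a Dirichlet sum; [W j], a multiple of its squared modulus, is the Fejer kernel value. *)
pose D j := \sum_(i < n) r j ^+ i.
pose W j : C := `|D j| ^+ 2 / n%:R ^+ 2.
have W0 j : 0 <= W j by rewrite divr_ge0// exprn_ge0.
have WS a : (a <= n)%N ->
    (\sum_j W j * r j ^+ a) *+ n = w ^+ 2 *+ a + 1 *+ (n - a).
  move=> an.
  (* As [r j] is unimodular and [r j ^+ n = w ^+ 2], its inverse powers become nonnegative ones, to
     which [rS] applies. *)
  have cD j : (D j)^* = \sum_(i < n) w ^- 2 * r j ^+ (n - i).
    rewrite rmorph_sum/=; apply: eq_bigr => i _.
    rewrite rmorphXn/= -[(r j)^*]mul1r -(mulVf (r0 j)) -mulrA -normCK r1.
    rewrite expr1n mulr1 exprVn -(rn j); apply: (mulfI (expf_neq0 i (r0 j))).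
    rewrite mulfV ?expf_neq0// mulrCA -exprD subnKC ?(ltnW (ltn_ord i))//.
    by rewrite mulVf// expf_neq0.
  have E i : \sum_j r j ^+ a * r j ^+ i * (D j)^* =
      w ^- 2 * \sum_(i' < n) \sum_j r j ^+ (a + i + (n - i')).
    rewrite exchange_big/= mulr_sumr; apply: eq_bigr => j _.
    rewrite cD !mulr_sumr; apply: eq_bigr => i' _.
    by rewrite mulrCA -!exprD.
  have -> : (\sum_j W j * r j ^+ a) *+ n =
      n%:R^-1 * \sum_(i < n) \sum_j r j ^+ a * r j ^+ i * (D j)^*.
    rewrite exchange_big/= mulr_sumr -mulr_natl mulr_sumr.
    apply: eq_bigr => j _; rewrite -mulr_suml -mulr_sumr -/(D j) /W normCK.
    by field.
  (* Orthogonality leaves the single index [(a + i) %% n]; the exponent there is [n] or [2 * n],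
     according to whether [a + i] wraps around. *)
  have S (i : 'I_n) : \sum_j r j ^+ a * r j ^+ i * (D j)^* =
      n%:R * (if (i < n - a)%N then 1 else w ^+ 2).
    have i0n : ((a + i) %% n < n)%N by rewrite ltn_mod.
    have N0 (i' : 'I_n) : i' != Ordinal i0n ->
        \sum_j r j ^+ (a + i + (n - i')) = 0.
      rewrite rS => i'i0; case: ifPn => // /dvdnP[q qn].
      case/negP: i'i0; apply/eqP/val_inj => /=.
      have : (a + i + n = q * n + i')%N by move: qn (ltn_ord i'); lia.
      by move=> /(congr1 (modn^~ n)); rewrite modnMDl modnDr (modn_small (ltn_ord i')).
    rewrite E (bigD1 (Ordinal i0n) (P := xpredT))//= [X in _ + X]big1 ?addr0//.
    rewrite rS; case: (ltnP i (n - a)%N) => ian.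
      rewrite modn_small; last by move: ian; lia.
      rewrite (_ : (a + i + (n - _) = n)%N); last by move: ian; lia.
      by rewrite dvdnn divnn n0 expr1 mulrCA mulVf ?mulr1// expf_neq0.
    have -> : ((a + i) %% n = a + i - n)%N.
      rewrite -{1}(@subnK n (a + i)); last by move: ian; lia.
      by rewrite modnDr modn_small//; move: (ltn_ord i) an; lia.
    rewrite (_ : (a + i + (n - _) = 2 * n)%N); last first.
      by move: ian (ltn_ord i) an; lia.
    by rewrite dvdn_mull// mulnK//; field.
  under eq_bigr do rewrite S.
  rewrite -mulr_sumr mulKf// -(big_mkord xpredT (fun i => if (i < n - a)%N then 1 else w ^+ 2)).
  rewrite (big_cat_nat _ (n := n - a)) ?leq_subr//= addrC; congr (_ + _).
    rewrite (eq_big_nat _ _ (F2 := fun=> w ^+ 2)) => [|i /andP[+ _]]; last first.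
      by rewrite ltnNge => ->.
    by rewrite sumr_const_nat subKn.
  rewrite (eq_big_nat _ _ (F2 := fun=> 1)) => [|i /andP[_ ->]//].
  by rewrite sumr_const_nat subn0.
have h2 j : sqrtC (r j) ^+ 2 = r j by rewrite sqrtCK.
have h1 j : `|sqrtC (r j)| = 1.
  by apply/eqP; rewrite -(@pexpr_eq1 _ _ 2)// ?normr_ge0// -normrX h2 r1.
have h0 j : sqrtC (r j) != 0 by rewrite -normr_eq0 h1 oner_eq0.
(* The factor [h j ^+ n] in [l j] turns the integrand into [r j ^+ a], and division by [w] turns the
   moments [WS] into combinations of [w] and [w^-1]. The total mass is the moment [a = 0]. *)
exists (fun j => sqrtC (r j)), (fun j => W j * sqrtC (r j) ^+ n / w); split => //.
  have lW j : `|W j * sqrtC (r j) ^+ n / w| = W j.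
    by rewrite normf_div w1 divr1 normrM normrX h1 expr1n mulr1 ger0_norm.
  under eq_bigr do rewrite lW.
  apply: (mulIf nC0); rewrite mul1r mulr_natr.
  have := WS 0%N isT; rewrite subn0 mulr0n add0r => <-.
  by congr (_ *+ _); apply: eq_bigr => j _; rewrite expr0 mulr1.
move=> a an.
rewrite (eq_bigr (fun j => w^-1 * (W j * r j ^+ a))) => [|j _]; last first.
  have -> : sqrtC (r j) ^+ n = sqrtC (r j) ^+ a * sqrtC (r j) ^+ (n - a).
    by rewrite -exprD subnKC.
  rewrite exprVn -[X in _ = _ * (_ * X ^+ a)]h2 -exprM mulnC exprM expr2.
  by field; rewrite w0 expf_neq0.
rewrite -mulr_sumr -mulrnAr WS// mulrDr !mulrnAr mulr1.
by congr (_ *+ _ + _); rewrite expr2 mulKf.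
Qed.

(** This is the operator y d/dy applied to the binomial expansion of (x + y)^(n+1). *)
Lemma sum_binomial_mul_index (A : comNzRingType) (x y : A) n :
  \sum_(i < n.+2) (x ^+ (n.+1 - i) * y ^+ i *+ 'C(n.+1, i)) *+ i =
  (y * (x + y) ^+ n) *+ n.+1.
Proof.
rewrite big_ord_recl mulr0n add0r exprDn mulr_sumr -sumrMnl.
apply: eq_bigr => i _; rewrite /= /bump/= add1n subSS exprS mulrnAr mulrCA.
by rewrite -!mulrnA [X in _ = _ *+ X]mulnC mul_bin_diag mulnC.
Qed.

(* The plane is encoded by the polynomials of degree at most 1, with 1 and 'X as
   orthonormal basis, and a symmetric [n]-linear form on it by a scalar map [B]
   on polynomials: its value at [n] vectors is [B] of their product. *)
Definition circle_vec z : {poly C} := ('Re z)%:P + 'Im z *: 'X.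

(** The two basis vectors are eigenvectors of all rotations: multiplying [z] by a unimodular [h]
    scales one component by [h] and the other by [h^-1]. *)
Lemma circle_vecE z : circle_vec z =
  z *: (2^-1 *: (1 - 'i *: 'X)) + z^* *: (2^-1 *: (1 + 'i *: 'X)).
Proof.
rewrite /circle_vec ReE ImE; set c := z^*; set e := 2^-1; set I := 'i.
by rewrite -!mul_polyC; ring.
Qed.

(** In the rotation eigenbasis, powers of rotated vectors expand with exactly the weights that
    [fejer_quadrature] evaluates. *)
Lemma circle_vec_polar n z : `|z| = 1 -> exists h l : 'I_n.+1 -> C,
  [/\ forall j, `|h j| = 1, \sum_j `|l j| = 1 &
   'X * circle_vec z ^+ n = \sum_j l j *: circle_vec (h j * z) ^+ n.+1].
Proof.
(* This [w] makes ['X] equal to [w *: U + w^-1 *: V], where [U] and [V] are the components of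
   [circle_vec z]. *)
move=> z1; pose w := 'i * z^*.
have w1 : `|w| = 1 by rewrite normrM normCi norm_conjC z1 mulr1.
have conjV u : `|u| = 1 -> u^* = u^-1.
  move=> u1; have u0 : u != 0 by rewrite -normr_eq0 u1 oner_eq0.
  by apply: (mulfI u0); rewrite mulfV// -normCK u1 expr1n.
have [h [l [h1 l1 hl]]] := fejer_quadrature (ltn0Sn n) w1.
exists h, l; split => //.
set P := 2^-1 *: (1 - 'i *: 'X) : {poly C}.
set Q := 2^-1 *: (1 + 'i *: 'X) : {poly C}.
pose U := z *: P; pose V := z^* *: Q.
have vE j : circle_vec (h j * z) = h j *: U + (h j)^-1 *: V.
  by rewrite circle_vecE rmorphM/= -!scalerA -/P -/Q -/U -/V conjV.
have XE : 'X = w *: U + w^-1 *: V.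
  have zz : z^* * z = 1 by rewrite mulrC -normCK z1 expr1n.
  have wV : w^-1 = - 'i * z by rewrite -conjV// /w rmorphM/= conjCK conjCi.
  rewrite /U /V (scalerA w z P) (scalerA _ _ Q) wV /w -!mulrA zz mulr1.
  rewrite (mulrC z) zz mulr1 /P /Q.
  transitivity ((- ('i * 'i) * (2^-1 + 2^-1) : C) *: ('X : {poly C})).
    by rewrite -expr2 sqrCi opprK -[2^-1]mul1r -splitr mulr1 scale1r.
  by set e := 2^-1; set I := 'i; rewrite -!mul_polyC; ring.
have ze : circle_vec z = U + V by rewrite circle_vecE.
clearbody U V; apply: (scalerI (_ : n.+1%:R != 0 :> C)); first by rewrite pnatr_eq0.
rewrite !scaler_nat.
under eq_bigr do rewrite vE.
transitivity (\sum_(i < n.+2) (w *+ (n.+1 - i) + w^-1 *+ i) *: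
  (U ^+ (n.+1 - i) * V ^+ i *+ 'C(n.+1, i))).
  have UE : \sum_(i < n.+2) (U ^+ (n.+1 - i) * V ^+ i *+ 'C(n.+1, i)) *+ (n.+1 - i) =
      (U * (U + V) ^+ n) *+ n.+1.
    apply: (addIr (\sum_(i < n.+2) (U ^+ (n.+1 - i) * V ^+ i *+ 'C(n.+1, i)) *+ i)).
    rewrite [in RHS]sum_binomial_mul_index -mulrnDl -mulrDl -exprS -big_split/= exprDn -sumrMnl.
    by apply: eq_bigr => i _; rewrite -mulrnDr subnK// -ltnS.
  rewrite XE ze mulrDl -(scalerAl w) -(scalerAl w^-1) mulrnDl !scalerMnr -UE -sum_binomial_mul_index.
  rewrite !scaler_sumr -big_split/=; apply: eq_bigr => i _.
  by rewrite scalerDl -!scalerMnl -!scalerMnr.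
rewrite (eq_bigr (fun j => \sum_(i < n.+2) (l j * (h j ^+ (n.+1 - i) * (h j)^-1 ^+ i)) *:
  (U ^+ (n.+1 - i) * V ^+ i *+ 'C(n.+1, i)))) => [|j _].
  rewrite exchange_big/= -sumrMnl; apply: eq_bigr => i _.
  have := hl (n.+1 - i)%N (leq_subr _ _); rewrite subKn -1?ltnS// => <-.
  by rewrite -scalerMnl scaler_suml.
rewrite exprDn scaler_sumr; apply: eq_bigr => i _.
by rewrite !exprZn -scalerAl -scalerAr !scalerMnr !scalerA !mulrA.
Qed.

(** One circle vector can be replaced by ['X] without loss, because the quadrature weights have
    total mass 1. *)
Lemma polar_circle_bound B n M : scalar B ->
  (forall z, `|z| = 1 -> `|B (circle_vec z ^+ n.+1)| <= M) ->
  forall z, `|z| = 1 -> `|B ('X * circle_vec z ^+ n)| <= M.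
Proof.
move=> linB BM z z1; have [h [l [h1 l1 ->]]] := circle_vec_polar n z1.
have B0 : B 0 = 0 by rewrite -[0](addNr 0) -scaleN1r linB mulN1r addNr.
have -> : B (\sum_j l j *: circle_vec (h j * z) ^+ n.+1) =
    \sum_j l j * B (circle_vec (h j * z) ^+ n.+1).
  apply: (big_ind2 (fun p x => B p = x)) => // [|j _]; last by rewrite -[_ *: _]addr0 linB B0 addr0.
  by move=> p x q y <- <-; rewrite -[p]scale1r linB mul1r scale1r.
apply: le_trans (ler_norm_sum _ _ _) _.
rewrite -[leRHS]mul1r -l1 mulr_suml; apply: ler_sum => j _.
by rewrite normrM ler_wpM2l// BM// normrM h1 z1 mulr1.
Qed.

Lemma monomial_circle_bound B n k M : scalar B -> (k <= n)%N ->
  (forall z, `|z| = 1 -> `|B (circle_vec z ^+ n)| <= M) -> `|B 'X^k| <= M.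
Proof.
move=> linB kn BM.
suff H j : (j <= n)%N -> forall z, `|z| = 1 ->
    `|B ('X^j * circle_vec z ^+ (n - j))| <= M.
  (* At [z = 1] the circle vector is the constant 1, so only ['X^k] remains. *)
  have := H k kn 1; rewrite normr1 /circle_vec.
  by rewrite (Creal_ReP _ _)// (Creal_ImP _ _)// scale0r addr0 expr1n mulr1; apply.
elim: j => [_ z z1|j IH jn z z1]; first by rewrite expr0 mul1r subn0 BM.
rewrite exprSr -mulrA.
apply: (@polar_circle_bound (fun p => B ('X^j * p))) => //.
  by move=> a u v; rewrite mulrDr -scalerAr linB.
by move=> u u1; rewrite subnSK// IH// ltnW.
Qed.
End Planar.

(** Banach's theorem for the real planar form whose value is [b j] at [n - j] copies of one basis
    vector and [j] of the other. It is extended to [R[i]], where roots of unity exist; circle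
    vectors keep real coordinates, so the hypothesis still covers them. *)
Lemma planar_coefficient_bound (R : rcfType) (b : nat -> R) n k M :
  (forall s t, s ^+ 2 + t ^+ 2 = 1 ->
    `|\sum_(j < n.+1) (s ^+ (n - j) * t ^+ j * b j) *+ 'C(n, j)| <= M) ->
  (k <= n)%N -> `|b k| <= M.
Proof.
move=> bM kn.
pose f := real_complex R.
pose B (p : {poly R[i]}) := \sum_(j < n.+1) p`_j * f (b j).
have linB : scalar B.
  move=> a p q; rewrite /B mulr_sumr -big_split; apply: eq_bigr => j _ /=.
  by rewrite coefD coefZ mulrDl mulrA.
have normf r : `|f r| = f `|r|.
  by rewrite normc_def /= expr0n addr0 sqrtr_sqr.
rewrite -lecR -[X in X <= _]normf.
have -> : f (b k) = B 'X^k.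
  rewrite /B (bigD1 (Ordinal (kn : (k < n.+1)%N)))//= coefXn eqxx mul1r.
  rewrite big1 ?addr0// => j jk; rewrite coefXn.
  by rewrite (negPf (_ : j != k :> nat)) ?mul0r.
apply: (monomial_circle_bound linB kn) => z z1.
rewrite /circle_vec -complexRe -complexIm.
have BE s t : B (((f s)%:P + f t *: 'X) ^+ n) =
    f (\sum_(j < n.+1) (s ^+ (n - j) * t ^+ j * b j) *+ 'C(n, j)).
  rewrite /f rmorph_sum; apply: eq_bigr => j _ /=; rewrite -/f.
  rewrite /f rmorphMn !rmorphM !rmorphXn /= -/f -mulrnAl; congr (_ * _).
  have cE (i : nat) : (((f s)%:P ^+ (n - i) * (f t *: 'X) ^+ i) *+ 'C(n, i))`_j =
      (f s ^+ (n - i) * f t ^+ i * (j == i :> nat)%:R) *+ 'C(n, i).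
    by rewrite coefMn exprZn -polyC_exp -scalerAr coefZ coefCM coefXn mulrCA mulrA.
  rewrite exprDn coef_sum (bigD1 j)//= cE eqxx mulr1 big1 ?addr0// => i ij.
  by rewrite cE eq_sym (negPf (ij : i != j :> nat)) mulr0 mul0rn.
rewrite BE normf lecR bM//; apply: complexI.
by rewrite add_Re2_Im2 z1 expr1n.
Qed.

(** * Bounded symmetric forms and their iterated Frechet derivatives *)

Section SymmetricForms.
Context (R : realType) (X : normedModType R).
Implicit Types (Y : normedModType R) (x y h : X) (s r : seq X).

(* A symmetric multilinear map in [n] variables is encoded by its values on
   the sequences of length [n]; permutation invariance makes linearity in the
   head enough. *)
Record bounded_sym_form Y n (A : seq X -> Y) : Prop := {
  sym_form_linear : forall s, size s = n.-1 -> (0 < n)%N ->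
    linear (fun h => A (h :: s));
  sym_form_perm : forall s r, size s = n -> perm_eq s r -> A s = A r;
  sym_form_bounded : exists M, forall s, size s = n ->
    `|A s| <= M * \prod_(x <- s) `|x| }.

Lemma sym_form_scalarD Y n A a b x y s : bounded_sym_form n.+1 A ->
  size s = n -> A (a *: x + b *: y :: s) = a *: A (x :: s) + b *: A (y :: s) :> Y.
Proof.
move=> AS sn; have L := sym_form_linear AS sn isT.
rewrite L; congr (_ + _).
have := L b y 0; have := L (-1) 0 0.
by rewrite scaler0 addr0 scaleN1r addNr => ->; rewrite !addr0.
Qed.

(** Pascal's rule for powers of the operator a + b S, with S the shift of the sequence [T]. *)
Lemma binomial_shift_sum Y (T : nat -> Y) (a b : R) n :
  \sum_(j < n.+1) (a ^+ (n - j) * b ^+ j *+ 'C(n, j)) *: (a *: T j + b *: T j.+1) =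
  \sum_(j < n.+2) (a ^+ (n.+1 - j) * b ^+ j *+ 'C(n.+1, j)) *: T j.
Proof.
pose c i := a ^+ (n.+1 - i) * b ^+ i.
rewrite [RHS]big_ord_recl.
rewrite [X in _ = _ + X](eq_bigr (fun i : 'I_n.+1 => (c i.+1 *+ 'C(n, i.+1)) *: T i.+1 +
    (c i.+1 *+ 'C(n, i)) *: T i.+1)); last first.
  by move=> i _; rewrite lift0 binS mulrnDr scalerDl.
have L : (c 0%N *+ 'C(n.+1, 0)) *: T 0%N +
    \sum_(i < n.+1) (c i.+1 *+ 'C(n, i.+1)) *: T i.+1 =
    \sum_(i < n.+2) (c i *+ 'C(n, i)) *: T i by rewrite [RHS]big_ord_recl !bin0.
rewrite big_split/= addrA L [X in _ = X + _]big_ord_recr/= bin_small// mulr0n scale0r addr0 -big_split/=.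
apply: eq_bigr => i _; rewrite scalerDr !scalerA.
have iN : (i <= n)%N by rewrite -ltnS.
rewrite /c; congr (_ *: _ + _ *: _); rewrite mulrnAl; congr (_ *+ _).
  by rewrite subSn// exprS; ring.
by rewrite subSS exprS; ring.
Qed.

(** The tail [s] serves the induction: one copy of the combination moves into it and is split by
    linearity afterwards. *)
Lemma sym_form_binomial Y n A a b x y s : bounded_sym_form (n + size s) A ->
  A (nseq n (a *: x + b *: y) ++ s) = \sum_(j < n.+1)
    (a ^+ (n - j) * b ^+ j *+ 'C(n, j)) *: A (nseq j y ++ nseq (n - j) x ++ s)
  :> Y.
Proof.
elim: n s => [|n IH] s AS.
  by rewrite big_ord_recl big_ord0 addr0 !expr0 mulr1 scale1r.
set v := a *: x + b *: y.
have -> : A (nseq n.+1 v ++ s) = A (nseq n v ++ v :: s).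
  apply: (sym_form_perm AS); first by rewrite size_cat size_nseq.
  by rewrite /= -cat1s perm_catCA.
rewrite IH; last by rewrite addnS.
rewrite -(binomial_shift_sum (fun j => A (nseq j y ++ nseq (n.+1 - j) x ++ s))).
apply: eq_bigr => j _; congr (_ *: _).
have jn : (j <= n)%N by rewrite -ltnS.
have sz : size (nseq j y ++ nseq (n - j) x ++ s) = (n + size s)%N.
  by rewrite !size_cat !size_nseq addnA subnKC.
have P u : A (nseq j y ++ nseq (n - j) x ++ u :: s) =
    A (u :: nseq j y ++ nseq (n - j) x ++ s).
  apply: (sym_form_perm AS); first by rewrite !size_cat/= !size_nseq; lia.
  by rewrite catA -(cat1s u s) perm_catCA/= catA.
rewrite P (sym_form_scalarD _ _ _ _ AS)//.
congr (_ *: _ + _ *: _); apply: (sym_form_perm AS); rewrite /= ?sz//.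
by rewrite subSn//= -cat1s perm_catCA.
Qed.

(** The polarized derivative of the diagonal of [A]: an operator-valued form in one variable less,
    which can be differentiated again. *)
Definition form_derivative Y n (A : seq X -> Y) s : clinType X Y :=
  clin_of (fun h => n%:R *: A (h :: s)).

Lemma linear_bound_continuous Y (f : X -> Y) M :
  linear f -> (forall h, `|f h| <= M * `|h|) -> continuous f.
Proof.
move=> lf fM.
pose F : {linear X -> Y} := HB.pack_for {linear X -> Y} (f : X -> Y)
  (GRing.isLinear.Build R X Y _ f lf).
suff : continuous F by [].
apply/linear_bounded_continuous/bounded_funP => r; exists (`|M| * r) => x xr.
rewrite (le_trans (fM x))// (le_trans (ler_norm _))// normrM normr_id.
by rewrite ler_wpM2l.
Qed.

Lemma clin_ofE Y (f : X -> Y) :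
  linear f -> continuous f -> clin_of f = f :> (X -> Y).
Proof. by move=> lf cf; rewrite /clin_of insubdK//; apply/asboolP. Qed.

Lemma form_slot_continuous Y n (A : seq X -> Y) s : bounded_sym_form n.+1 A ->
  size s = n -> linear (fun h => n.+1%:R *: A (h :: s)) /\
    continuous (fun h => n.+1%:R *: A (h :: s)).
Proof.
move=> AS sn; have lA : linear (fun h => n.+1%:R *: A (h :: s)).
  move=> a u v; rewrite (sym_form_linear AS sn)// scalerDr !scalerA.
  by rewrite [_ * a]mulrC.
split=> //; have [M AM] := sym_form_bounded AS.
apply: (@linear_bound_continuous _ _ (n.+1%:R * (M * \prod_(x <- s) `|x|))) => // h.
rewrite normrZ normr_nat -!mulrA ler_wpM2l//.
by have := AM (h :: s); rewrite /= sn big_cons [_ * `|h|]mulrC; apply.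
Qed.

Lemma form_derivativeE Y n (A : seq X -> Y) s h : bounded_sym_form n.+1 A ->
  size s = n -> form_derivative n.+1 A s h = n.+1%:R *: A (h :: s).
Proof. by move=> AS sn; have [lA cA] := form_slot_continuous AS sn; rewrite clin_ofE. Qed.

Lemma form_derivative_sym_form Y n (A : seq X -> Y) : bounded_sym_form n.+1 A ->
  bounded_sym_form n (form_derivative n.+1 A).
Proof.
move=> AS; split.
- case: n AS => // n AS s sn _ a u v /=; apply/val_inj/funext => h /=.
  rewrite !fctE !form_derivativeE//= ?sn//.
  have P w : A (h :: w :: s) = A (w :: h :: s).
    apply: (sym_form_perm AS); first by rewrite /= sn.
    by rewrite -(cat1s h) -(cat1s w) perm_catCA.
  by rewrite !P (sym_form_linear AS)/= ?sn// scalerDr !scalerA [_ * a]mulrC.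
- move=> s r sn sr; apply/val_inj/funext => h /=.
  have rn : size r = n by rewrite -(perm_size sr).
  rewrite !form_derivativeE//; congr (_ *: _).
  by apply: (sym_form_perm AS); rewrite /= ?sn// perm_cons.
- have [M AM] := sym_form_bounded AS.
  exists (n.+1%:R * `|M|) => s sn; rewrite clin_normE; apply: ge_sup.
    by exists `|form_derivative n.+1 A s 0|, 0; rewrite /= ?normr0.
  move=> _ [h /= h1 <-]; rewrite form_derivativeE// normrZ normr_nat -mulrA.
  rewrite ler_wpM2l//; have := AM (h :: s); rewrite /= sn => /(_ erefl)/le_trans; apply.
  rewrite (le_trans (ler_norm _))// normrM ler_wpM2l// big_cons normrM normr_id.
  have p0 : 0 <= \prod_(x <- s) `|x| by apply: prodr_ge0.
  by rewrite (ger0_norm p0) ler_piMl.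
Qed.

(** In the binomial expansion at [h + x], the terms of index 0 and 1 are the value and the
    differential; the others are quadratically small in [h]. *)
Lemma diff_sym_form Y n (A : seq X -> Y) x : bounded_sym_form n.+1 A ->
  'd (fun x => A (nseq n.+1 x)) x = (fun h => n.+1%:R *: A (h :: nseq n x)) :> (X -> Y).
Proof.
move=> AS; have [lA cA] := form_slot_continuous AS (size_nseq n x).
pose F : {linear X -> Y} := HB.pack_for {linear X -> Y}
  (fun h => n.+1%:R *: A (h :: nseq n x)) (GRing.isLinear.Build R X Y _ _ lA).
apply: (@diff_unique _ _ _ _ F) => //.
have [M AM] := sym_form_bounded AS.
pose K := \sum_(j < n.+2) 'C(n.+1, j)%:R * (`|M| * `|x| ^+ (n.+1 - j)).
have K0 : 0 <= K by apply: sumr_ge0 => j _; rewrite !mulr_ge0.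
have rK h : `|h| <= 1 -> `|A (nseq n.+1 (h + x)) - (A (nseq n.+1 x) + F h)| <= K * `|h| ^+ 2.
  move=> h1; pose t j := A (nseq j h ++ nseq (n.+1 - j) x).
  have -> : A (nseq n.+1 (h + x)) = \sum_(j < n.+2) 'C(n.+1, j)%:R *: t j.
    have := @sym_form_binomial Y n.+1 A 1 1 x h [::].
    rewrite addn0 !cats0 !scale1r [x + h]addrC => -> //.
    by apply: eq_bigr => j _; rewrite !expr1n mulr1 cats0.
  have -> : A (nseq n.+1 x) + F h = 'C(n.+1, 0)%:R *: t 0%N + 'C(n.+1, 1)%:R *: t 1%N.
    by rewrite bin0 bin1 scale1r /t subn0 subn1.
  rewrite 2!big_ord_recl addrA [_ + \sum_(_ < _) _]addrC addrK.
  apply: le_trans (ler_norm_sum _ _ _) _.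
  rewrite mulr_suml 2!big_ord_recl addrA ler_wpDl ?addr_ge0 ?mulr_ge0//.
  apply: ler_sum => i _; rewrite normrZ normr_nat -!mulrA ler_wpM2l//.
  rewrite !lift0; have i2 : (i.+2 <= n.+1)%N by have := ltn_ord i; lia.
  apply: le_trans (AM _ _) _; first by rewrite size_cat !size_nseq subnKC.
  rewrite (le_trans (ler_norm _))// normrM ler_wpM2l// big_cat !big_nseq/=.
  rewrite !iter_mulr_1 normrM !normrX !normr_id mulrC ler_wpM2l//.
  by rewrite ger0_norm ?mulr_ge0 ?exprn_ge0// mulrA -expr2 ler_piMr ?exprn_ge0 ?exprn_ile1.
apply/eqaddoP => _/posnumP[e]; near=> h.
rewrite /= /shift/= !fctE -/(F h).
have h1 : `|h| <= 1.
  by near: h; apply: nbhs0_le.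
apply: le_trans (rK h h1) _; rewrite expr2 mulrA ler_wpM2r//.
(* [K + 1] is positive even if [K] vanishes. *)
suff : `|h| <= e%:num / (K + 1).
  rewrite ler_pdivlMr ?ltr_wpDl// => /(le_trans _); apply.
  by rewrite mulrC ler_wpM2l// lerDl.
near: h; apply: nbhs0_le; rewrite divr_gt0// ltr_wpDl//.
Unshelve. all: by end_near.
Qed.

Fixpoint iter_form_derivative n k (A : seq X -> R) : seq X -> mlinType X k :=
  if k is j.+1 then form_derivative (n - j) (iter_form_derivative n j A) else A.

(** Each derivative is again the diagonal of a bounded symmetric form, so [diff_sym_form] applies at
    every order and no default value of [frechet] arises. *)
Lemma frechet_sym_form n k A : bounded_sym_form n (A : seq X -> R^o) -> (k <= n)%N ->
  bounded_sym_form (n - k) (iter_form_derivative n k A) /\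
  frechet k (fun x => A (nseq n x)) =
    fun x => iter_form_derivative n k A (nseq (n - k) x).
Proof.
move=> AS; elim: k => [_|k IH kn]; first by rewrite subn0.
have [IHS /= IHd] := IH (ltnW kn).
have nk : (n - k = (n - k.+1).+1)%N by rewrite subnSK.
rewrite IHd; rewrite nk in IHS *.
split; first exact: form_derivative_sym_form.
by apply/funext => x /=; rewrite /form_derivative -diff_sym_form.
Qed.

Lemma mlin_diagZ k (B : mlinType X k) c y :
  mlin_diag (c *: B) y = c * mlin_diag B y.
Proof. by elim: k B => //= k IH B; rewrite -IH. Qed.

(** The successive derivatives contribute the factors n, n-1, ..., n-k+1. *)
Lemma mlin_diag_form_derivative n k A s y : bounded_sym_form n (A : seq X -> R^o) ->
  (k <= n)%N -> size s = (n - k)%N ->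
  mlin_diag (iter_form_derivative n k A s) y = A (nseq k y ++ s) *+ n ^_ k.
Proof.
move=> AS; elim: k s => [|k IH] s kn sn //=.
have [IS _] := frechet_sym_form AS (ltnW kn).
have nk : (n - k = (n - k.+1).+1)%N by rewrite subnSK.
have Ay : A (nseq k y ++ y :: s) = A (y :: nseq k y ++ s).
  apply: (sym_form_perm AS); first by rewrite size_cat size_nseq /= sn; lia.
  by rewrite -(cat1s y s) perm_catCA.
rewrite nk in IS *; rewrite form_derivativeE// mlin_diagZ IH ?(ltnW kn)//=; last first.
  by rewrite sn nk.
by rewrite Ay ffactnSr nk mulrnA mulr_natl.
Qed.

(** By homogeneity nonzero arguments are rescaled to norm [e]; a zero argument makes [A] vanish. *)
Lemma sym_form_bounded_of_small Y n (A : seq X -> Y) (e : R) : 0 < e ->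
  (forall s, size s = n.-1 -> (0 < n)%N -> linear (fun h => A (h :: s))) ->
  (forall s r, size s = n -> perm_eq s r -> A s = A r) ->
  (forall s, size s = n -> (forall x, x \in s -> `|x| <= e) -> `|A s| <= 1) ->
  forall s, size s = n -> `|A s| <= e^-1 ^+ n * \prod_(x <- s) `|x|.
Proof.
move=> e0 lA pA As1.
have AZ c x s : size s = n.-1 -> (0 < n)%N -> A (c *: x :: s) = c *: A (x :: s).
  move=> sn n0; have L := lA _ sn n0; have := L c x 0; have := L (-1) 0 0.
  by rewrite scaler0 addr0 scaleN1r addNr => ->; rewrite !addr0.
have AZs (g : X -> R) s r : size (s ++ r) = n ->
    A ([seq g x *: x | x <- s] ++ r) = (\prod_(x <- s) g x) *: A (s ++ r).
  elim: s r => [|x s IH] r /= sn; first by rewrite big_nil scale1r.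
  have P s' : size (x :: s' ++ r) = n -> A (x :: s' ++ r) = A (s' ++ x :: r).
    by move=> sz; apply: pA => //; rewrite -(cat1s x r) perm_sym perm_catCA.
  have sz : size ([seq g x *: x | x <- s] ++ r) = n.-1.
    by rewrite -sn !size_cat size_map.
  have n0 : (0 < n)%N by rewrite -sn.
  rewrite AZ// P; last by rewrite /= sz prednK.
  by rewrite IH ?size_cat/= ?addnS -?size_cat// -P// big_cons scalerA.
move=> s sn; have [s0|s0] := boolP (0 \in s).
  have sz : size (rem 0 s) = n.-1 by rewrite size_rem// sn.
  have n0 : (0 < n)%N by rewrite -sn; case: (s) s0.
  have -> : A s = 0.
    rewrite (pA _ (0 :: rem 0 s))//; last exact: perm_to_rem.
    by rewrite -(scale0r (0 : X)) AZ// scale0r.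
  by rewrite normr0 mulr_ge0 ?prodr_ge0// exprn_ge0// invr_ge0 ltW.
have := AZs (fun x => e / `|x|) s [::]; rewrite !cats0 => /(_ sn) AE.
have := As1 [seq (e / `|x|) *: x | x <- s]; rewrite size_map => /(_ sn) H.
have {H} : `|A [seq (e / `|x|) *: x | x <- s]| <= 1.
  apply: H => _ /mapP[x xs ->]; rewrite normrZ normrM normfV normr_id.
  by rewrite mulfVK ?normr_eq0 ?(memPn s0)// gtr0_norm.
have p0 : 0 < \prod_(x <- s) `|x|.
  rewrite big_seq; apply: prodr_gt0 => x xs; rewrite normr_gt0.
  by apply: contraNneq s0 => <-.
rewrite AE normrZ big_split/= big_const_seq count_predT sn iter_mulr_1.
rewrite prodfV ger0_norm; last first.
  by rewrite mulr_ge0 ?exprn_ge0 ?invr_ge0// ltW.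
rewrite mulrAC ler_pdivrMr// mul1r => H.
by rewrite exprVn [leRHS]mulrC ler_pdivlMr ?exprn_gt0// mulrC.
Qed.

Lemma ptws_continuous_bound n (L : {ptws 'I_n -> X} -> R) :
  {for (fun=> 0), continuous L} -> L (fun=> 0) = 0 ->
  exists2 e : R, 0 < e & forall v, (forall i, `|v i| <= e) -> `|L v| <= 1.
Proof.
move=> cL L0.
have := cL [set y | `|y| < 1].
have B1 : nbhs (0 : R) [set y : R | `|y| < 1].
  by apply/nbhs_ballP; exists 1 => //= y; rewrite /ball/= sub0r normrN.
rewrite L0 => /(_ B1) nL.
pose z : {uniform 'I_n -> X} := fun=> 0.
(* The uniform topology refines the pointwise one, so the preimage contains a uniform neighborhood
   of 0. *)
have := @pointwise_uniform_cvg 'I_n X (fun=> 0) (nbhs z) _ (@cvg_refl _ (nbhs z)) _ nL.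
move=> H; have {H}[E [/= entE EL]] := proj1 (@uniform_nbhs _ _ _ z _) (H _).
have /nbhs_ballP[e /= e0 eE] : nbhs (0 : X) [set y | E (0, y)].
  by rewrite -nbhs_entourageE; exists E => // y /xsectionP.
exists (e / 2) => [|v ve]; first by rewrite divr_gt0.
apply/ltW/EL => i _; apply: eE; rewrite -ball_normE/= sub0r normrN.
by rewrite (le_lt_trans (ve i))// ltr_pdivrMr// ltr_pMr// ltr1n.
Qed.

Lemma sym_form_of_hpoly n P : continuous_hpoly n P ->
  exists2 A : seq X -> R^o, bounded_sym_form n A & P = fun x => A (nseq n x).
Proof.
move=> [L [mL sL cL PL]].
pose A s : R^o := L (fun i : 'I_n => nth 0 s i).
have lA s : size s = n.-1 -> (0 < n)%N -> linear (fun h => A (h :: s)).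
  rewrite /A; case: n L mL {sL cL PL A} => // n L mL sn _ a u v.
  have E h : (fun i : 'I_n.+1 => nth 0 (h :: s) i) =
      dfwith (fun i : 'I_n.+1 => nth 0 (0 :: s) i) ord0 h.
    apply/funext => i; have [->|i0] := eqVneq i ord0; first by rewrite dfwithin.
    by rewrite dfwithout 1?eq_sym//; case: i i0 => -[].
  by rewrite (E (a *: u + v)) (E u) (E v) mL.
have pA s r : size s = n -> perm_eq s r -> A s = A r.
  move=> sn sr; have rn : size r == n by rewrite -(perm_size sr) sn.
  have /tuple_permP[p sp] : perm_eq s (Tuple rn) by [].
  rewrite /A -[RHS](sL p); congr L; apply/funext => i /=.
  by rewrite sp -tnth_nth tnth_mktuple (tnth_nth 0).
exists A; last first.
  by apply/funext => x; rewrite PL; congr L; apply/funext => i; rewrite nth_nseq ltn_ord.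
have [n0|n0] := posnP n.
  split => //; exists `|A [::]| => s sn.
  by rewrite (_ : s = [::]) ?big_nil ?mulr1//; apply: size0nil; rewrite sn.
have L0 : L (fun=> 0) = 0.
  have := mL (Ordinal n0) (fun=> 0) (-1) 0 0.
  have -> : dfwith (fun=> 0 : X) (Ordinal n0) (-1 *: 0 + 0) = fun=> 0.
    by apply/funext => i; rewrite scaler0 addr0; case: dfwithP.
  have -> : dfwith (fun=> 0 : X) (Ordinal n0) 0 = fun=> 0.
    by apply/funext => i; case: dfwithP.
  by rewrite mulN1r addNr.
have [e e0 Le] := ptws_continuous_bound (cL _) L0.
split => //; exists (e^-1 ^+ n); apply: (sym_form_bounded_of_small e0) => // s sn se.
by apply: Le => i; apply: se; rewrite mem_nth// sn.
Qed.

End SymmetricForms.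

(** * Comparison of the numerical constants *)

Lemma hoelder_conjugate_le2 (R : realType) (p : \bar R) : (2%:E <= p)%E ->
  (hoelder_conjugate p <= 2%:E)%E.
Proof.
case: p => [r||]//; rewrite ?hoelder_conjugatey ?lee_fin ?ler1n// => r2.
rewrite /hoelder_conjugate/= eqe gt_eqF; last lra.
rewrite -EFinB inver gt_eqF; last lra.
rewrite -EFinM lee_fin ler_pdivrMr; lra.
Qed.

(** For [0 < k < n], Pascal's rule gives two distinct terms of the previous row, whose total is
    2^(n-1). *)
Lemma bin_le_pow2 n k : (0 < n)%N -> (0 < k)%N -> ('C(n, k) <= 2 ^ n.-1)%N.
Proof.
case: n k => // n [//|k] _ _ /=; rewrite binS.
case: (ltnP k n) => [kn|]; last first.
  rewrite leq_eqVlt => /predU1P[<-|nk].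
    by rewrite bin_small// binn expn_gt0.
  by rewrite !bin_small// ltnW.
rewrite -[in leqRHS](addn1 1) Pascal.
have k1 : (k < n.+1)%N by exact: ltnW.
rewrite (bigD1 (Ordinal k1))//= (bigD1 (Ordinal (kn : k.+1 < n.+1)%N))//=.
  by rewrite !exp1n !muln1 addnA [X in (X <= _)%N]addnC leq_addr.
by rewrite -val_eqE/= gtn_eqF.
Qed.

Lemma fine_natdiv (R : realType) n (q : \bar R) : (1 <= q)%E ->
  fine (n%:R%:E / q)%E = n%:R * fine (q^-1)%E.
Proof.
case: q => [r||]//.
by rewrite lee_fin => r1; rewrite inver gt_eqF//; lra.
Qed.

(** Writing [m - k] and [k] as multiples of [m] cancels the powers of [m]. The remaining bases lie
    in [0, 1], so raising them to the power 1/q, at least 1/2, gives at most what square roots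
    give. *)
Lemma Cexponent_ge (R : realType) m k (q : \bar R) : (0 < k <= m)%N ->
  (1 <= q <= 2%:E)%E ->
  k`!%:R <= Cexponent k m q *
    (Num.sqrt ((m - k)%:R / m%:R) ^+ (m - k) * Num.sqrt (k%:R / m%:R) ^+ k).
Proof.
move=> /andP[k0 km] /andP[q1 q2].
rewrite /Cexponent !fine_natdiv//.
set r := fine (q^-1)%E.
have r2 : 2^-1 <= r.
  rewrite /r; case: q q1 q2 {r} => [x||]//; rewrite !lee_fin => x1 x2.
  rewrite inver gt_eqF/=; last lra.
  rewrite lef_pV2 ?posrE//; lra.
have m0 : 0 < m%:R :> R by rewrite ltr0n; lia.
have sqrt_ge (j : nat) : (j <= m)%N -> 0 < (j%:R / m%:R) `^ (j%:R * r) /\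
    (j%:R / m%:R) `^ (j%:R * r) <= Num.sqrt (j%:R / m%:R) ^+ j :> R.
  (* Index 0 occurs when [k = m]; both powers are then 1. *)
  case: j => [_|j jm]; first by rewrite !mul0r powRr0.
  have x0 : 0 < j.+1%:R / m%:R :> R by rewrite divr_gt0.
  split; first exact: powR_gt0.
  rewrite -powR12_sqrt ?divr_ge0// -powR_mulrn ?powR_ge0// -powRrM.
  apply: ger_powR; first by rewrite x0 ler_pdivrMr// mul1r ler_nat.
  by rewrite mulrC ler_wpM2l.
have split_powR (j : nat) : j%:R `^ (j%:R * r) =
    (j%:R / m%:R) `^ (j%:R * r) * m%:R `^ (j%:R * r) :> R.
  by rewrite -powRM ?divr_ge0// divfK// gt_eqF.
have mE : m%:R `^ (m%:R * r) = m%:R `^ ((m - k)%:R * r) * m%:R `^ (k%:R * r) :> R.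
  rewrite -powRD; last by apply/implyP => _; rewrite lt0r_neq0.
  by rewrite -mulrDl -natrD subnK.
have [a0 aA] := sqrt_ge (m - k)%N (leq_subr _ _).
have [b0 bB] := sqrt_ge k km.
rewrite mE (split_powR (m - k)%N) (split_powR k).
move: a0 aA b0 bB; set a := _ `^ _; set A := Num.sqrt _ ^+ _.
move=> a0 aA; set b := _ `^ _; set B := Num.sqrt _ ^+ _ => b0 bB.
have := powR_gt0 ((m - k)%:R * r) m0; have := powR_gt0 (k%:R * r) m0.
set u := _ `^ _ => u0; set v := _ `^ _ => v0.
have -> : k`!%:R * (v * u) / (a * v * (b * u)) * (A * B) = k`!%:R * ((A * B) / (a * b)).
  by field; rewrite !gt_eqF.
rewrite ler_peMr// ler_pdivlMr ?mulr_gt0// mul1r.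
by rewrite ler_pM// ltW.
Qed.

(** Every branch uses an exponent in [1, 2]: p <= m' <= 2 in the first, m' in the second, and p' in
    the third, where p > m >= 2. *)
Lemma Cconst_ge (R : realType) m k (p : \bar R) : (1 <= p)%E -> (2 <= m)%N ->
  (0 < k <= m)%N ->
  k`!%:R <= Cconst k m p *
    (Num.sqrt ((m - k)%:R / m%:R) ^+ (m - k) * Num.sqrt (k%:R / m%:R) ^+ k).
Proof.
move=> p1 m2 km; have m'2 : (hoelder_conjugate m%:R%:E <= 2%:E :> \bar R)%E.
  by apply: hoelder_conjugate_le2; rewrite lee_fin ler_nat.
have m1 : (1 <= m%:R%:E :> \bar R)%E by rewrite lee_fin ler1n; lia.
rewrite /Cconst; case: ifPn => [pm'|_]; last case: ifPn => [_|].
- by apply: Cexponent_ge; rewrite // p1 (le_trans pm').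
- by apply: Cexponent_ge; rewrite // m'2 hoelder_conj_ge1.
- rewrite -ltNge => mp; apply: Cexponent_ge; rewrite // hoelder_conj_ge1//.
  apply/hoelder_conjugate_le2/(le_trans _ (ltW mp)).
  by rewrite lee_fin ler_nat.
Qed.

(** * Norm estimates for the derivatives *)

Lemma sqrt_ratio_expn_gt0 (R : realType) n k :
  (0 < n)%N -> 0 < Num.sqrt (k%:R / n%:R) ^+ k :> R.
Proof.
move=> n0; case: k => [|k]; first by rewrite expr0.
by rewrite exprn_gt0// sqrtr_gt0 divr_gt0// ltr0n.
Qed.

Lemma poly_norm_fin_num (R : realType) (X : normedModType R) n (P : X -> R) :
  continuous_hpoly n P -> poly_norm P \is a fin_num.
Proof.
move=> /sym_form_of_hpoly[A AS ->]; have [M AM] := sym_form_bounded AS.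
rewrite fin_numElt; apply/andP; split.
  apply: (@lt_le_trans _ _ `|A (nseq n 0)|%:E); first exact: ltNyr.
  by apply: ereal_sup_ubound; exists 0; rewrite //= normr0.
apply: le_lt_trans (ltry `|M|); apply: ge_ereal_sup => _ [x /= x1 <-].
rewrite lee_fin (le_trans (AM _ _)) ?size_nseq// (le_trans (ler_norm _))//.
by rewrite big_nseq iter_mulr_1 normrM normrX normr_id ler_piMr// exprn_ile1.
Qed.

Lemma frechet_norm_le (R : realType) (X : normedModType R) n k (P : X -> R) :
  (0 < k <= n)%N -> continuous_hpoly n P ->
  (frechet_norm k P <= ((n ^_ k)%:R / (Num.sqrt ((n - k)%:R / n%:R) ^+ (n - k) *
    Num.sqrt (k%:R / n%:R) ^+ k))%:E * poly_norm P)%E.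
Proof.
move=> /andP[k0 kn] cP; have Pfin := poly_norm_fin_num cP.
have [A AS PA] := sym_form_of_hpoly cP.
have [_ fE] := frechet_sym_form AS kn.
set M := fine (poly_norm P).
have PM z : `|z| <= 1 -> `|P z| <= M.
  by move=> z1; rewrite -lee_fin fineK//; apply: ereal_sup_ubound; exists z.
have n0 : 0 < n%:R :> R by rewrite ltr0n; lia.
set a := (n - k)%:R / n%:R; set b := k%:R / n%:R.
have ab : a + b = 1 by rewrite -mulrDl -natrD subnK// divff// gt_eqF.
have a0 : 0 <= a by rewrite divr_ge0.
have b0 : 0 < b by rewrite divr_gt0// ltr0n.
have sa0 : 0 < Num.sqrt a ^+ (n - k) by apply: sqrt_ratio_expn_gt0; lia.
have sb0 : 0 < Num.sqrt b ^+ k by apply: sqrt_ratio_expn_gt0; lia.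
apply: ge_ereal_sup => _ [x /= x1 <-]; apply: ge_ereal_sup => _ [y /= y1 <-].
rewrite -(fineK Pfin) -EFinM lee_fin -/M PA fE.
rewrite mlin_diag_form_derivative ?size_nseq// normrMn -[leLHS]mulr_natl -mulrA.
rewrite ler_wpM2l// mulrC ler_pdivlMr ?mulr_gt0//.
(* With the weights absorbed into [c], the binomial sum at a circle point [(s, t)] becomes a value
   of [P]. *)
pose c j := Num.sqrt a ^+ (n - j) * Num.sqrt b ^+ j * A (nseq j y ++ nseq (n - j) x).
suff : `|c k| <= M.
  by rewrite /c normrM (gtr0_norm (mulr_gt0 sa0 sb0)) mulrC.
apply: (planar_coefficient_bound _ kn) => s t st1.
have -> : \sum_(j < n.+1) (s ^+ (n - j) * t ^+ j * c j) *+ 'C(n, j) =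
    P ((s * Num.sqrt a) *: x + (t * Num.sqrt b) *: y).
  have := @sym_form_binomial _ _ R^o n A (s * Num.sqrt a) (t * Num.sqrt b) x y [::].
  rewrite addn0 cats0 PA => -> //; apply: eq_bigr => j _; rewrite cats0 /c.
  by rewrite !exprMn -scalerMnl; congr (_ *+ _); rewrite /GRing.scale/=; ring.
apply: PM.
(* The two resulting bounds add up to 1, since s^2 + t^2 = 1 and a + b = 1. *)
have amgm u v : 0 <= v -> `|u| * `|Num.sqrt v| <= (u ^+ 2 + v) / 2.
  move=> v0; rewrite (ger0_norm (sqrtr_ge0 v)) -{2}(sqr_sqrtr v0).
  rewrite -(real_normK (num_real u)).
  have := sqr_ge0 (`|u| - Num.sqrt v); lra.
apply: (le_trans (ler_normD _ _)); rewrite !normrZ.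
apply: (@le_trans _ _ ((s ^+ 2 + a) / 2 + (t ^+ 2 + b) / 2)); last by lra.
by apply: lerD; rewrite -[leRHS]mulr1 ler_pM// ?mulr_ge0// amgm// ltW.
Qed.

Theorem proposition9 (R : realType) (d : measure_display)
    (T : measurableType d) (mu : {measure set T -> \bar R})
    (p : \bar R) (p1 : (1 <= p)%E) (m k : nat)
    (m2 : (2 <= m)%N) (k1 : (1 <= k)%N) (km : (k <= m)%N)
    (P : LspaceType mu p1 -> R) :
  continuous_hpoly m P ->
  (frechet_norm k P <= (2 ^+ m.-1 * Cconst k m p)%:E * poly_norm P)%E.
Proof.
move=> cP; have km' : (0 < k <= m)%N by rewrite k1.
apply: le_trans (frechet_norm_le km' cP) _; apply: lee_wpmul2r.
  apply: (@le_trans _ _ `|P 0|%:E); first by rewrite lee_fin.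
  by apply: ereal_sup_ubound; exists 0; rewrite //= normr0.
rewrite lee_fin; set D := _ * _ ^+ k.
have D0 : 0 < D by apply: mulr_gt0; apply: sqrt_ratio_expn_gt0; lia.
(* The falling factorial splits into a binomial coefficient, bounded by 2^(m-1), and [k!], bounded
   through [Cconst_ge]. *)
rewrite ler_pdivrMr// -mulrA -bin_ffact natrM ler_pM//.
  by rewrite -natrX ler_nat bin_le_pow2//; lia.
exact: Cconst_ge.
Qed.
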